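(* Let $n\ge2$. For every workload $\mathcal T$ of $n$ transactions with global balancing ratio $\beta$, with probability at least $1-1/n$ Algorithm Non-Clairvoyant satisfies $$CR_{Non\text{-}Clairvoyant}(\mathcal T)\le 512e\,\ell\sqrt{s/\beta}\,\ln n+1=O\!\left(\ell\sqrt{s/\beta}\,\log n\right).$$ In particular, for balanced workloads ($\beta=\Theta(1)$) with $\ell=O(1)$, $CR_{Non\text{-}Clairvoyant}(\mathcal T)=O(\sqrt s\log n)$ with probability at least $1-1/n$.
   Context: Model. A workload is a set $\mathcal T=\{T_1,\dots,T_n\}$ of $n\ge1$ transactions (one per thread), all issued at time $0$, over a set $\mathcal R=\{R_1,\dots,R_s\}$ of $s$ shared resources. Each transaction $T$ reads the resources in $\mathcal R_r(T)$ and writes those in $\mathcal R_w(T)$; $\mathcal R(T)=\mathcal R_r(T)\cup\mathcal R_w(T)$, $\lambda(T)=|\mathcal R(T)|\ge1$, $\lambda_w(T)=|\mathcal R_w(T)|$. $T$ is read-only if $\lambda_w(T)=0$ and writing otherwise; at least one transaction is writing. Transactions $T,T'$ conflict if some resource lies in $(\mathcal R_w(T)\cap\mathcal R(T'))\cup(\mathcal R(T)\cap\mathcal R_w(T'))$; the conflict graph has the transactions as vertices and an edge between each conflicting pair. Time is discrete and synchronous; each transaction $T_i$ has a fixed integer execution time $\tau_i\ge1$ and commits once it has executed $\tau_i$ consecutive time steps without being aborted. Whenever two running transactions conflict, the contention manager aborts one of them; an aborted transaction restarts immediately from scratch (greedy schedule). The makespan of an algorithm on a workload is the time until all its transactions have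 committed; $\mathrm{makespan}_{opt}$ is the minimum makespan of any schedule in which conflicting transactions never execute simultaneously (optimal offline scheduler); the competitive ratio is $CR_{\mathcal A}=\mathrm{makespan}_{\mathcal A}/\mathrm{makespan}_{opt}$. The balancing ratio of a writing transaction is $\beta(T)=\lambda_w(T)/\lambda(T)\in[1/s,1]$; the global balancing ratio $\beta$ is the minimum of $\beta(T)$ over writing transactions. $\tau_{\max}=\max_i\tau_i$, $\tau_{\min}=\min_i\tau_i$, $\ell=\lceil\log_2(\tau_{\max}/\tau_{\min})\rceil+1$. Grouping. Writing transactions are partitioned into groups $A_0,\dots,A_{\ell-1}$, where $A_i$ contains those with execution time in $[2^i\tau_{\min},(2^{i+1}-1)\tau_{\min}]$; each $A_i$ is partitioned into subgroups $A_i^0,\dots,A_i^{\kappa-1}$, $\kappa=\lceil\log_2 s\rceil+1$, where $A_i^j$ contains those $T$ with $\lambda(T)\in[\lambda^j_{\min},\lambda^j_{\max}]$, $\lambda^j_{\min}=2^j$, $\lambda^j_{\max}=2^{j+1}-1$. Read-only transactions form a group $B$. Subgroups are ordered by $A_i^j<A_k^l$ iff $i<k$ or ($i=k$ and $j<l$), and $B$ is placed after all subgroups. Algorithm Non-Clairvoyant. All pending transactions execute at every step. Every time a transaction $T$ (re)starts it draws $r(T)$ uniformly at random from $\{1,\dots,n\}$, independently. When running transactions $T_u\in A_i^j$ and $T_v\in A_k^l$ conflict: if $A_i^j<A_k^l$ then $T_u$ aborts $T_v$; if $A_i^j>A_k^l$ then $T_v$ aborts $T_u$; if they are in the same subgroup,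 then $T_u$ aborts $T_v$ if $r(T_u)<r(T_v)$ and otherwise $T_v$ aborts $T_u$; moreover, after $T_u$ aborts $T_v$ on account of $r(T_u)<r(T_v)$, the restarted $T_v$ cannot abort $T_u$ until $T_u$ commits or is aborted.
   Formalization: Group A_i is taken as execution times in [2^i τ_min, 2^{i+1} τ_min), since the stated intervals leave gaps (τ_min=2, τ=3 lies in no group); ties in r are won by the smaller index; the O-form and the ''in particular'' corollary, which are immediate, are not stated. *)

(* Defs.v *)
From mathcomp Require Import all_boot.
From Stdlib Require Import Reals.

Set Implicit Arguments.
Unset Strict Implicit.
Unset Printing Implicit Defensive.

Record workload (n s : nat) := Workload {
  rdset : 'I_n -> {set 'I_s};
  wrset : 'I_n -> {set 'I_s};
  tau   : 'I_n -> nat }.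

Section Workload.
Variables (n s : nat) (W : workload n s).

Definition resources (i : 'I_n) : {set 'I_s} := rdset W i :|: wrset W i.
Definition lambda (i : 'I_n) : nat := #|resources i|.
Definition lambda_w (i : 'I_n) : nat := #|wrset W i|.
Definition writing (i : 'I_n) : bool := wrset W i != set0.

Definition conflict (u v : 'I_n) : bool :=
  (wrset W u :&: resources v != set0) || (resources u :&: wrset W v != set0).

Definition tau_max : nat := \max_(i < n) tau W i.
Definition tau_min : nat := \big[minn/tau_max]_(i < n) tau W i.

(* ell = ceil(log2(tau_max/tau_min)) + 1 ; ceil(log2 x) = least e with x <= 2^e,
   and tau_max <= 2^e tau_min  <->  ceil(tau_max/tau_min) <= 2^e. *)
Definition ell : nat := (up_log 2 ((tau_max + tau_min).-1 %/ tau_min)).+1.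

Definition is_global_balancing_ratio (beta : R) : Prop :=
  (exists i, writing i /\ beta = (INR (lambda_w i) / INR (lambda i))%R) /\
  (forall i, writing i -> (beta <= INR (lambda_w i) / INR (lambda i))%R).

Definition feasible (start : 'I_n -> nat) : Prop :=
  forall u v, u != v -> conflict u v ->
    start u + tau W u <= start v \/ start v + tau W v <= start u.
Definition sched_makespan (start : 'I_n -> nat) : nat :=
  \max_(i < n) (start i + tau W i).
Definition is_opt_makespan (M : nat) : Prop :=
  (exists start, feasible start /\ sched_makespan start = M) /\
  (forall start, feasible start -> M <= sched_makespan start).

(* Grouping: group index of a writing transaction = largest i with
   2^i tau_min <= tau; subgroup index = largest j with 2^j <= lambda.
   Read-only transactions form group B, placed after all subgroups. *)
Definition gidx (i : 'I_n) : nat := trunc_log 2 (tau W i %/ tau_min).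
Definition sidx (i : 'I_n) : nat := trunc_log 2 (lambda i).

Definition sub_lt (u v : 'I_n) : bool :=
  writing u && (~~ writing v || (gidx u < gidx v) ||
                ((gidx u == gidx v) && (sidx u < sidx v))).

Record state := State {
  done : 'I_n -> bool;
  prog : 'I_n -> nat;           (* consecutive steps executed since last (re)start *)
  rnd  : 'I_n -> 'I_n;          (* current random value r (0..n-1 ~ 1..n) *)
  prot : 'I_n -> 'I_n -> bool   (* prot u v : v may not abort u *)
}.

Definition running (st : state) (i : 'I_n) : bool := ~~ done st i.

Definition rwin (st : state) (u v : 'I_n) : bool :=
  (rnd st u < rnd st v) || ((rnd st u == rnd st v) && (u < v)).

Definition beats (st : state) (u v : 'I_n) : bool :=
  if sub_lt u v then true else if sub_lt v u then false
  else if prot st u v then true else if prot st v u then false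
  else rwin st u v.

Definition aborted (st : state) (v : 'I_n) : bool :=
  running st v &&
  [exists u, [&& u != v, running st u, conflict u v & beats st u v]].

Definition commits (st : state) (i : 'I_n) : bool :=
  running st i && ~~ aborted st i && (tau W i <= (prog st i).+1).

Definition step (st : state) (d : 'I_n -> 'I_n) : state :=
  State (fun i => done st i || commits st i)
        (fun i => if aborted st i then 0
                  else if running st i then (prog st i).+1 else prog st i)
        (fun i => if aborted st i then d i else rnd st i)
        (fun u v => [&& running st u, ~~ aborted st u, ~~ commits st u &
            prot st u v ||
            [&& u != v, running st v, conflict u v, ~~ sub_lt u v,
                ~~ sub_lt v u, ~~ prot st v u & rwin st u v]]).

(* w t i = random value drawn by transaction i when it (re)starts at time t *)
Fixpoint run (w : nat -> 'I_n -> 'I_n) (t : nat) : state :=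
  match t with
  | 0 => State (fun _ => false) (fun _ => 0) (w 0) (fun _ _ => false)
  | t'.+1 => step (run w t') (w t)
  end.

Definition all_done (st : state) : bool := [forall i, done st i].

(* Draws for restart times 0..T, i.i.d. uniform in 'I_n. *)
Definition drawfun (T : nat) (om : {ffun 'I_T.+1 * 'I_n -> 'I_n})
  (k : nat) (i : 'I_n) : 'I_n :=
  match (insub k : option 'I_T.+1) with Some k' => om (k', i) | None => i end.

(* Pr[ makespan of Non-Clairvoyant <= T ] *)
Definition prob_done_by (T : nat) : R :=
  (INR #|[set om : {ffun 'I_T.+1 * 'I_n -> 'I_n} |
           all_done (run (drawfun om) T)]|
   / INR #|{ffun 'I_T.+1 * 'I_n -> 'I_n}|)%R.

End Workload.

(* Main.v *)
From mathcomp Require Import all_boot all_order all_algebra zify.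
From mathcomp Require ring lra.
From Stdlib Require Import FunctionalExtensionality.
Require Import Defs.

(** A transaction that survives one step becomes protected against all running
    rivals of its subgroup; once the smaller subgroups are finished it is never
    aborted again.  Every other running transaction has just been aborted and has
    a fresh draw, so each step is an independent round of a random-priority
    competition.  A step of an unsettled transaction [v] is either blocked by a
    settled rival, which happens at most (number of rivals) * (longest execution)
    times since settled rivals run to completion, or is a trial that succeeds with
    probability at least 1 / (5 * (number of rivals + 1)).

    In a subgroup with at most [g] writers per resource and at most [2^(j+1)]
    resources per transaction, orienting conflicts towards writers shows that in
    every set of pending transactions at least half have fewer than [8 * 2^j * g]
    rivals.  Hence the expected number of pending transactions shrinks by a factor
    3/4 in each phase of length [O(min(2^j g, m)) * tau], with [m] the size of the
    subgroup, and O(ln n) phases per subgroup leave none by Markov's inequality.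
    An optimal schedule has length at least [g * tau] and at least
    [beta * 2^j * m * tau / s], so the phase lengths are bounded by
    [min(2^j, s / (beta 2^j))] times the optimum, and this sums over [j] to
    [O(sqrt (s / beta))]. *)

Set Implicit Arguments.
Unset Strict Implicit.
Unset Printing Implicit Defensive.

(** * One step of the algorithm *)

Section Dynamics.
Variables (n s : nat) (W : workload n s).
Hypothesis tau_gt0 : forall i, 0 < tau W i.
Implicit Types (st : state n) (u v x : 'I_n) (d : 'I_n -> 'I_n).

Lemma conflictC u v : conflict W u v = conflict W v u.
Proof. by rewrite /conflict orbC; congr (_ || _); rewrite setIC. Qed.

Lemma rwinN st u v : u != v -> ~~ rwin st v u -> rwin st u v.
Proof.
rewrite /rwin -(inj_eq val_inj) [rnd st v == _]eq_sym -!(inj_eq val_inj) /=; lia.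
Qed.

Lemma rwin_asym st u v : rwin st u v -> ~~ rwin st v u.
Proof.
rewrite /rwin [rnd st v == _]eq_sym -!(inj_eq val_inj) /=; lia.
Qed.

(** Adjacency in the conflict graph of a single subgroup. Read-only transactions have no rivals:
    they do not conflict with each other, and writing ones precede them. *)
Definition rival u v :=
  [&& u != v, conflict W u v, ~~ sub_lt W u v & ~~ sub_lt W v u].

Lemma rivalC u v : rival u v = rival v u.
Proof.
by rewrite /rival eq_sym conflictC; do 2!congr (_ && _); rewrite andbC.
Qed.

(** Invariant of reachable states. Its heart is [coh_prot]: progress since the last restart amounts
    to protection against every running rival. *)
Record coherent st : Prop := Coherent {
  coh_tau : forall u, running st u -> prog st u < tau W u;
  coh_asym : forall u v, prot st u v -> ~~ prot st v u;
  coh_prog : forall u v, prot st u v -> 0 < prog st u;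
  coh_prot : forall u v, running st u -> running st v -> rival u v ->
    0 < prog st u -> prot st u v }.

Lemma running_step st d u : running (step W st d) u -> running st u.
Proof. by rewrite /running /= negb_or => /andP[]. Qed.

Lemma coherent_step st d : coherent st -> coherent (step W st d).
Proof.
move=> [h1 h2 h3 h4]; split.
- move=> u ru; have ru' := running_step ru.
  move: ru; rewrite /running /= negb_or /commits => /andP[_].
  by rewrite ru'; case: ifP => //= _; rewrite -ltnNge.
- move=> u v /= /and4P[_ _ _ /orP[puv|/and5P[uv rv cf su /and3P[sv pvu wuv]]]].
    apply/negP => /and4P[_ _ _ /orP[pvu|]].
      by have := h2 _ _ puv; rewrite pvu.
    by rewrite puv /= !andbF.
  apply/negP => /and4P[_ _ _]; rewrite (negPf pvu) /= => /and5P[_ _ _ _ /and3P[_ _]].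
  by apply/negP; apply: rwin_asym.
- by move=> u v /= /and4P[-> /negPf -> _ _].
- move=> u v ru rv riv.
  have ru' := running_step ru; have rv' := running_step rv.
  move: ru; rewrite {1}/running /= negb_or ru' => /andP[_ ncu].
  case: ifP => //= nab _; rewrite ncu /=.
  have [//|/= npuv] := boolP (prot st u v).
  have /and4P[uv cf suv svu] := riv.
  rewrite uv rv' cf suv svu /=.
  (* As [u] was not aborted, [v] did not beat it; hence [v] holds no protection and, [rwin] being
     total, [u] won on draws and becomes protected now. *)
  have nb : ~~ beats W st v u.
    apply: contraFN nab => b; rewrite /aborted ru'; apply/existsP; exists v.
    by rewrite eq_sym uv rv' conflictC cf.
  move: nb; rewrite /beats (negPf suv) (negPf svu) (negPf npuv).
  by case: ifP => //= _; apply: rwinN.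
Qed.

(** Redrawing every value at each step turns the run into a Markov chain driven by independent
    draws. *)
Definition redraw st d := State (done st) (prog st) d (prot st).
Definition nstep st d := step W (redraw st d) d.

Lemma coherent_redraw st d : coherent st -> coherent (redraw st d).
Proof. by case=> *; split. Qed.

Lemma coherent_nstep st d : coherent st -> coherent (nstep st d).
Proof. by move=> h; apply/coherent_step/coherent_redraw. Qed.

Fixpoint nrun st (w : nat -> 'I_n -> 'I_n) k : state n :=
  if k is k'.+1 then nrun (nstep st (w 0)) (fun t => w t.+1) k' else st.

Lemma nrunSr st w k : nrun st w k.+1 = nstep (nrun st w k) (w k).
Proof. by elim: k st w => // k IH st w /=; rewrite -IH. Qed.

(* Two running rivals have [prot] deciding between them as soon as one of them
   has made progress, so only the draws of freshly restarted ones matter. *)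
Lemma redraw_fresh st d d' : coherent st ->
    (forall u, running st u -> prog st u = 0 -> rnd st u = d u) ->
  [/\ done (step W st d') = done (nstep st d),
      prog (step W st d') = prog (nstep st d) &
      prot (step W st d') = prot (nstep st d)].
Proof.
move=> [h1 h2 h3 h4] hd.
have hw u v : running st u -> running st v -> rival u v -> ~~ prot st u v ->
    ~~ prot st v u -> rwin (redraw st d) u v = rwin st u v.
  move=> ru rv riv puv pvu; rewrite /rwin /= !hd //.
    by case: (posnP (prog st v)) => // /(h4 v u rv ru); rewrite rivalC riv (negPf pvu) => /(_ isT).
  by case: (posnP (prog st u)) => // /(h4 u v ru rv riv); rewrite (negPf puv).
have ha v : aborted W (redraw st d) v = aborted W st v.
  rewrite /aborted {1 3}/running /=; case rv: (done st v) => //=.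
  apply: eq_existsb => u; have [//|uv] := eqVneq u v => /=.
  rewrite /running /=; case ru: (done st u) => //=; case cf: (conflict W u v) => //=.
  rewrite /beats; case: ifP => // /negbT suv; case: ifP => // /negbT svu /=.
  case: ifP => // /negbT puv; case: ifP => // /negbT pvu.
  by apply: hw; rewrite /rival ?uv ?cf ?suv ?svu /running ?ru ?rv.
have hc v : commits W (redraw st d) v = commits W st v by rewrite /commits ha.
rewrite /nstep /step /=; split.
- by apply: functional_extensionality => u; rewrite hc.
- by apply: functional_extensionality => u; rewrite ha.
apply: functional_extensionality => u; apply: functional_extensionality => v.
rewrite ha hc /running /=; case ru: (done st u) => //=; do 2!congr (_ && _).
case puv: (prot st u v) => //=; case: eqVneq => //= uv; case rv: (done st v) => //=.
case cf: (conflict W u v) => //=; case suv: (sub_lt W u v) => //=.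
case svu: (sub_lt W v u) => //=; case pvu: (prot st v u) => //=.
by rewrite hw // /rival /running ?uv ?ru ?rv ?cf ?suv ?svu ?puv ?pvu.
Qed.

Lemma coherent_run w t : coherent (run W w t).
Proof. by elim: t => [|t IH]; [split=> //= *; rewrite tau_gt0 | apply: coherent_step]. Qed.

Definition start_state d : state n := State (fun _ => false) (fun _ => 0) d (fun _ _ => false).

Lemma coherent_start d : coherent (start_state d).
Proof. exact: (coherent_run (fun=> d) 0). Qed.

Lemma rnd_run_fresh w t u :
  running (run W w t) u -> prog (run W w t) u = 0 -> rnd (run W w t) u = w t u.
Proof.
case: t => //= t /running_step; rewrite /running => /negPf du.
by rewrite /running du; case: (aborted _ _ _).
Qed.

Lemma done_run_nrun d0 w t : done (run W w t) = done (nrun (start_state d0) w t).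
Proof.
suff [] : [/\ done (run W w t) = done (nrun (start_state d0) w t),
   prog (run W w t) = prog (nrun (start_state d0) w t) &
   prot (run W w t) = prot (nrun (start_state d0) w t)] by [].
elim: t => // t [h1 h2 h3]; rewrite nrunSr.
(* Draws that decide a fight in step [t] were made at time [t], as in [nstep]; the row [w t.+1]
   handed out by [step] is read one step later. *)
have [e1 e2 e3] := redraw_fresh (w t.+1) (coherent_run w t) (@rnd_run_fresh w t).
by rewrite -[run W w t.+1]/(step W (run W w t) (w t.+1)) e1 e2 e3 /nstep /redraw h1 h2 h3.
Qed.

Definition unobstructed st v := forall u, sub_lt W u v -> done st u.

Lemma done_nstep st d u : done st u -> done (nstep st d) u.
Proof. by move=> /= ->. Qed.

Lemma unobstructed_nstep st d v : unobstructed st v -> unobstructed (nstep st d) v.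
Proof. by move=> h u /h; apply: done_nstep. Qed.

Lemma rival_writing u v : writing W v -> rival u v -> writing W u.
Proof. by move=> wv /and4P[_ _ _]; rewrite /sub_lt wv; case: (writing W u). Qed.

Lemma rival_sub_lt x u v : writing W v -> rival u v -> sub_lt W x u = sub_lt W x v.
Proof.
move=> wv riv; have wu := rival_writing wv riv.
move: riv => /and4P[_ _]; rewrite /sub_lt wu wv /=; case: (writing W x) => //=; lia.
Qed.

Lemma rival_unobstructed st u v :
  writing W v -> rival u v -> unobstructed st v -> unobstructed st u.
Proof. by move=> wv riv h x; rewrite (rival_sub_lt x wv riv); apply: h. Qed.

(** Smaller subgroups are finished, and by coherence progress carries protection against every
    running rival. *)
Lemma settled_survives st d v : coherent st -> unobstructed st v ->
  0 < prog st v -> ~~ aborted W (redraw st d) v.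
Proof.
move=> h top pv; apply/negP => /andP[rv /existsP[u /and4P[uv ru cf]]].
have nuv : ~~ sub_lt W u v by apply: contraL ru => /top; rewrite /running negbK.
rewrite /beats (negPf nuv); case: ifP => // /negbT nvu /=.
have pvu : prot st v u.
  by apply: (coh_prot h) => //; rewrite rivalC /rival uv cf nuv nvu.
by rewrite pvu (negPf (coh_asym h pvu)).
Qed.

(** Rivals without progress hold no protection, by [coh_prog], so at worst the draws decide. *)
Lemma free_survives st d v : coherent st -> unobstructed st v ->
    (forall u, rival u v -> running st u -> prog st u = 0 /\ d v < d u) ->
  ~~ aborted W (redraw st d) v.
Proof.
move=> h top hd; apply/negP => /andP[rv /existsP[u /and4P[uv ru cf]]].
have nuv : ~~ sub_lt W u v by apply: contraL ru => /top; rewrite /running negbK.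
rewrite /beats (negPf nuv); case: ifP => // /negbT nvu /=.
have [pu lt_d] : prog st u = 0 /\ d v < d u by apply: hd; rewrite // /rival uv cf nuv.
have -> : prot st u v = false by apply/negP => /(coh_prog h); rewrite pu.
by case: ifP => // _; rewrite /rwin /= -(inj_eq val_inj) /=; lia.
Qed.

Definition rivals v := [set u | rival u v].
Definition live st v := [set u in rivals v | running st u].

Lemma live_nstep st d v : #|live (nstep st d) v| <= #|live st v|.
Proof.
apply/subset_leq_card/subsetP => u; rewrite !inE => /andP[-> /=].
exact: running_step.
Qed.

(** Potential that pays for blocked steps: each of them uses up at least one unit. *)
Definition load st v := \sum_(u in live st v) (tau W u - prog st u).

Lemma loadE st v :
  load st v = \sum_(u in rivals v) (if running st u then tau W u - prog st u else 0).
Proof. by rewrite -big_mkcondr; apply: eq_bigl => u; rewrite inE. Qed.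

Lemma load_term st d u : coherent st -> unobstructed st u ->
  (if running (nstep st d) u then tau W u - prog (nstep st d) u else 0)
    + (0 < prog st u) * running st u
    <= (if running st u then tau W u - prog st u else 0).
Proof.
move=> h top; case: ifP => [/[dup] ru' /running_step ru|_].
  have {}ru : running st u by [].
  rewrite ru /= -/(redraw st d); have := coh_tau h ru.
  case: (posnP (prog st u)) => [->|pu]; first lia.
  have rr : running (redraw st d) u by [].
  by rewrite (negPf (settled_survives d h top pu)) rr; lia.
by case: ifP => ru; rewrite ?muln0 // muln1; have := coh_tau h ru; lia.
Qed.

Lemma load_nstep st d v : writing W v -> coherent st -> unobstructed st v ->
  load (nstep st d) v <= load st v.
Proof.
move=> wv h top; rewrite !loadE; apply: leq_sum => u; rewrite inE => riv.
apply: leq_trans (load_term d h (rival_unobstructed wv riv top)); exact: leq_addr.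
Qed.

Lemma load_blocked st d u v : writing W v -> coherent st -> unobstructed st v ->
  rival u v -> running st u -> 0 < prog st u -> load (nstep st d) v < load st v.
Proof.
move=> wv h top riv ru pu; rewrite !loadE.
rewrite (bigD1 u) ?inE //= [X in _ < X](bigD1 u) ?inE //= -addSn; apply: leq_add.
  by have := load_term d h (rival_unobstructed wv riv top); rewrite pu ru addn1.
apply: leq_sum => x; rewrite inE => /andP[rx _].
apply: leq_trans (load_term d h (rival_unobstructed wv rx top)); exact: leq_addr.
Qed.
End Dynamics.

(** * Probability of winning a round *)

(** Bernoulli's inequality for the base 1 - 1/N, cleared of denominators. *)
Lemma expn_bernoulli N i : N ^ i * (N - i) <= N * N.-1 ^ i.
Proof.
elim: i => [|i IH]; first by rewrite !expn0 subn0 mul1n muln1.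
rewrite !expnSr mulnA; apply: leq_trans (leq_mul IH (leqnn N.-1)).
rewrite -!mulnA leq_mul2l; apply/orP; right.
have [iN|Ni] := ltnP i N; last by rewrite (_ : N - i.+1 = 0) ?muln0 //; lia.
have [m ->] : exists m, N = (i + m).+1 by exists (N - i.+1); lia.
by rewrite !subSS !addKn subSn ?leq_addr // addKn /=; nia.
Qed.

Lemma balanced_mul N x y : y <= x -> x <= y.+1 -> N <= x + y -> 1 < N ->
  N * N <= 5 * (x * y).
Proof.
move=> yx xy Nxy N1; apply: leq_trans (leq_mul Nxy Nxy) _.
have [->|->] : x = y \/ x = y.+1 by lia.
  by nia.
by case: y yx xy Nxy => [|y] *; [lia | nia].
Qed.

(** Bernoulli at exponent [j] degenerates when [j] is close to [N]; applied to two halves of [j] it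
    loses only a constant factor. *)
Lemma expn_predn_ratio N j : 1 < N -> j <= N -> N ^ j <= 5 * N.-1 ^ j.
Proof.
move=> N1 jN; have [j1 [j2 [ej d1 d2]]] : exists j1 j2, [/\ j = j1 + j2, j1 <= j2 & j2 <= j1.+1].
  by exists j./2, (uphalf j); rewrite -{1}(odd_double_half j) uphalf_half; split; lia.
have h1 := expn_bernoulli N j1; have h2 := expn_bernoulli N j2.
have := leq_mul h1 h2; rewrite mulnACA -expnD -ej [X in _ <= X]mulnACA -expnD -ej => h.
(* The two factors differ by at most one and their sum [2 * N - j] is at least [N]. *)
have h5 : N * N <= 5 * ((N - j1) * (N - j2)) by apply: balanced_mul; lia.
have NN : 0 < N * N by rewrite muln_gt0; lia.
rewrite -(leq_pmul2l NN); apply: leq_trans (_ : 5 * (N ^ j * ((N - j1) * (N - j2))) <= _).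
  by rewrite [X in _ <= X]mulnCA mulnC leq_mul2l h5 orbT.
by rewrite [X in _ <= X]mulnCA leq_mul2l h orbT.
Qed.

(** For [N] above 1, Bernoulli bounds (1 + 1/(N-1))^N below by 1 + N/(N-1), which exceeds 2. *)
Lemma expn_half_bound N : 0 < N -> 2 * N.-1 ^ N <= N ^ N.
Proof.
case: N => // m _ /=; case: m => [//|m].
have h k : m.+1 ^ k * (m.+1 + k) <= m.+1 * m.+2 ^ k.
  elim: k => [|k IH]; first by rewrite !expn0; lia.
  rewrite !expnSr mulnA; apply: leq_trans (leq_mul IH (leqnn m.+2)).
  by rewrite -!mulnA leq_mul2l; apply/orP; right; nia.
have := h m.+2; set a := m.+1 ^ _; set b := m.+2 ^ _ => hab.
rewrite -(leq_pmul2l (ltn0Sn m)); apply: leq_trans hab; nia.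
Qed.

Lemma expnS_sub_le a k : a.+1 ^ k.+1 <= a ^ k.+1 + k.+1 * a.+1 ^ k.
Proof.
elim: k => [|k IH]; first by rewrite !expn1 expn0; lia.
have h : a ^ k.+1 <= a.+1 ^ k.+1 by rewrite leq_exp2r.
rewrite (expnSr _ k.+1) (expnSr a k.+1).
have := leq_mul IH (leqnn a); rewrite mulnDl -mulnA => {}IH.
have e : a.+1 ^ k.+1 = a.+1 ^ k * a + a.+1 ^ k by rewrite expnSr mulnS addnC.
move: IH h; rewrite e; set x := a.+1 ^ k; set y := a ^ k.+1; set z := x * a.
nia.
Qed.

(** Discrete form of comparing the sum with the integral of the power function; [expnS_sub_le] is
    the telescoping increment. *)
Lemma sum_expn_ge n k : n.-1 ^ k.+1 <= k.+1 * \sum_(b < n) b ^ k.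
Proof.
elim: n => [|[|n] IH]; rewrite ?exp0n //.
rewrite big_ord_recr /= mulnDr; apply: leq_trans (expnS_sub_le n k) _.
by rewrite leq_add2r.
Qed.

Definition wins n (A : {set 'I_n}) v (d : {ffun 'I_n -> 'I_n}) :=
  [forall u in A, d v < d u].

Lemma card_gt_rev_ord n (a : 'I_n) : #|[pred b : 'I_n | rev_ord a < b]| = a.
Proof.
rewrite -sum1_card (reindex_inj rev_ord_inj) /=.
rewrite (eq_bigl (fun b : 'I_n => b < a)) => [|b]; last first.
  by rewrite inE /=; have := ltn_ord a; have := ltn_ord b; lia.
by rewrite -(big_ord_widen n (fun=> 1)) ?(ltnW (ltn_ord a)) // sum1_card card_ord.
Qed.

Lemma card_wins n (A : {set 'I_n}) v : v \notin A ->
  #|[set d | wins A v d]| = (\sum_(b < n) b ^ #|A|) * n ^ (n - #|A|.+1).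
Proof.
move=> vA; pose Fa (a x : 'I_n) : pred 'I_n :=
  if x == v then pred1 a else if x \in A then [pred b : 'I_n | a < b] else predT.
have famP a (d : {ffun 'I_n -> 'I_n}) : (d \in family (Fa a)) = (d v == a) && wins A v d.
  apply/familyP/andP => [h|[/eqP <- /forall_inP h] x].
    have := h v; rewrite /Fa eqxx inE => /eqP <-; rewrite eqxx; split=> //.
    apply/forall_inP => u uA; have := h u; rewrite /Fa uA.
    by case: eqP uA vA => [->->|_ _ _] //; have := h v; rewrite /Fa eqxx !inE => /eqP ->.
  rewrite /Fa; case: eqP => [->|_]; first exact: eqxx.
  by case: ifP => // /h.
rewrite -sum1_card (partition_big (fun d : {ffun 'I_n -> 'I_n} => d v) predT) //=.
(* The count is split by the value of [v]. After reversal exactly [a] values lie above it, so the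
   members of [A] contribute [a ^ #|A|]. *)
rewrite big_distrl /= (reindex_inj rev_ord_inj) /=; apply: eq_bigr => a _.
rewrite sum1_card; transitivity #|family (Fa (rev_ord a))|.
  by apply: eq_card => d; rewrite famP unfold_in inE andbC.
rewrite card_family foldrE big_image /=.
rewrite (bigD1 v) //= {1}/Fa eqxx card1 mul1n (bigID [in A]) /=.
congr (_ * _).
  rewrite (eq_bigl [in A]); last first.
    by move=> x; case: eqP => // ->; rewrite (negPf vA).
  rewrite -prod_nat_const; apply: eq_bigr => x xA.
  rewrite /Fa xA; case: eqP => [e|_]; first by rewrite e (negPf vA) in xA.
  exact: card_gt_rev_ord.
transitivity (\prod_(x in ~: (v |: A)) n).
  apply: eq_big => x; rewrite ?inE ?negb_or // => /andP[/negPf xv /negPf xA].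
  by rewrite /Fa xv xA -[RHS]card_ord; apply: eq_card.
by rewrite prod_nat_const cardsCs setCK cardsU1 vA card_ord.
Qed.

(** With [k = #|A|], the power sum is at least (n-1)^(k+1) / (k+1), and replacing the base [n - 1]
    by [n] costs a factor of at most 5. *)
Lemma card_wins_ge n (A : {set 'I_n}) v : 1 < n -> v \notin A ->
  n ^ n <= 5 * #|A|.+1 * #|[set d | wins A v d]|.
Proof.
move=> n1 vA; rewrite card_wins //; set k := #|A|.
have kn : k < n by have := max_card [in v |: A]; rewrite cardsU1 vA card_ord.
rewrite mulnA -{2}(subnKC kn) expnD; apply: leq_mul => //.
apply: leq_trans (expn_predn_ratio n1 kn) _.
by rewrite -mulnA leq_mul2l /= sum_expn_ge.
Qed.

(** * Expectations along the run *)

Section Expectation.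
Import GRing.Theory Num.Theory Order.TTheory.
Import mathcomp.algebra_tactics.ring mathcomp.algebra_tactics.lra.
Local Open Scope ring_scope.

Variables (F : realFieldType) (n s : nat) (W : workload n s).
Local Notation draw := {ffun 'I_n -> 'I_n}.
Implicit Types (st : state n) (f g : state n -> F).

Definition mean (f : draw -> F) : F := (\sum_d f d) / #|draw|%:R.

Hypothesis n_gt1 : (1 < n)%N.
Hypothesis tau_gt0 : forall i, (0 < tau W i)%N.

Let card_draw_gt0 : 0 < #|draw|%:R :> F.
Proof. by rewrite ltr0n card_ffun !card_ord expn_gt0 ltnW. Qed.

Lemma ler_mean (f g : draw -> F) : (forall d, f d <= g d) -> mean f <= mean g.
Proof. by move=> h; rewrite ler_pM2r ?invr_gt0 //; apply: ler_sum. Qed.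

Lemma eq_mean (f g : draw -> F) : f =1 g -> mean f = mean g.
Proof. by move=> h; congr (_ / _); apply: eq_bigr. Qed.

Lemma mean_const (c : F) : mean (fun=> c) = c.
Proof. by rewrite /mean sumr_const -[c *+ _]mulr_natr mulfK // gt_eqF. Qed.

Lemma meanZ (f : draw -> F) c : mean (fun d => f d * c) = mean f * c.
Proof. by rewrite /mean -mulr_suml mulrAC. Qed.

Lemma meanD (f g : draw -> F) : mean (fun d => f d + g d) = mean f + mean g.
Proof. by rewrite /mean big_split mulrDl. Qed.

Lemma mean_sum (I : finType) (P : pred I) (f : I -> draw -> F) :
  mean (fun d => \sum_(i | P i) f i d) = \sum_(i | P i) mean (f i).
Proof. by rewrite /mean exchange_big mulr_suml. Qed.

Lemma mean_lose_le (A : {set 'I_n}) v D : v \notin A -> (#|A| < D)%N ->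
  mean (fun d => (~~ wins A v d)%:R) <= 1 - (5 * D)%:R^-1.
Proof.
move=> vA AD; have := card_wins_ge n_gt1 vA; set w := #|[set d | _]| => hw.
have -> : mean (fun d => (~~ wins A v d)%:R) = 1 - w%:R / #|draw|%:R.
  have <- : mean (fun d => (wins A v d)%:R) = w%:R / #|draw|%:R.
    congr (_ / _); rewrite -natr_sum; congr _%:R; rewrite /w -sum1_card [RHS]big_mkcond /=.
    by apply: eq_bigr => d _; rewrite inE; case: wins.
  apply/eqP; rewrite -subr_eq opprK -meanD; apply/eqP.
  rewrite -[RHS](mean_const 1).
  by apply: eq_mean => d; case: wins; rewrite ?addr0 ?add0r.
rewrite lerD2l lerN2 ler_pdivlMr // ler_pdivrMl; last by rewrite ltr0n; lia.
rewrite -natrM ler_nat card_ffun !card_ord; apply: leq_trans hw _.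
by rewrite leq_mul2r leq_mul2l /= AD orbT.
Qed.

(** Expectation after [k] steps with independent uniform draws, by averaging over the first one;
    [Ex_add] is the Markov property. *)
Fixpoint Ex k f st : F :=
  if k is k'.+1 then mean (fun d => Ex k' f (nstep W st d)) else f st.

Lemma ExS k f st : Ex k.+1 f st = mean (fun d => Ex k f (nstep W st d)).
Proof. by []. Qed.

Lemma Ex_add k l f st : Ex (k + l) f st = Ex k (Ex l f) st.
Proof. by elim: k st => //= k IH st; apply: eq_mean => d; apply: IH. Qed.

Lemma ler_Ex (Q : state n -> Prop) k f g st :
    (forall st' d, Q st' -> Q (nstep W st' d)) ->
    (forall st', Q st' -> f st' <= g st') ->
  Q st -> Ex k f st <= Ex k g st.
Proof.
move=> cQ h; elim: k st => /= [|k IH] st hst; first exact: h.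
by apply: ler_mean => d; apply/IH/cQ.
Qed.

Lemma Ex_const k c st : Ex k (fun=> c) st = c.
Proof. by elim: k st => //= k IH st; under eq_mean do rewrite IH; apply: mean_const. Qed.

Lemma Ex_le1 k (b : state n -> bool) st : Ex k (fun st' => (b st')%:R) st <= 1.
Proof.
rewrite -[leRHS](Ex_const k 1 st).
by apply: (@ler_Ex xpredT) => // st' _; case: (b st'); rewrite ?ler01.
Qed.

Lemma ExD k f g st : Ex k (fun st' => f st' + g st') st = Ex k f st + Ex k g st.
Proof. by elim: k st => //= k IH st; under eq_mean do rewrite IH; apply: meanD. Qed.

Lemma ExZ k f c st : Ex k (fun st' => f st' * c) st = Ex k f st * c.
Proof. by elim: k st => //= k IH st; under eq_mean do rewrite IH; apply: meanZ. Qed.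

Lemma Ex_sum k (I : finType) (P : pred I) (f : I -> state n -> F) st :
  Ex k (fun st' => \sum_(i | P i) f i st') st = \sum_(i | P i) Ex k (f i) st.
Proof. by elim: k st => //= k IH st; under eq_mean do rewrite IH; apply: mean_sum. Qed.

(** Nothing random remains: under [Q] the transaction advances at every step until it commits. *)
Lemma Ex_running_eq0 (Q : state n -> Prop) v k st :
    (forall st' d, Q st' -> Q (nstep W st' d)) ->
    (forall st' d, Q st' -> running st' v -> ~~ aborted W (redraw st' d) v) ->
    Q st -> (running st v -> tau W v <= k + prog st v)%N ->
    (running st v -> prog st v < tau W v)%N ->
  Ex k (fun st' => (running st' v)%:R) st = 0.
Proof.
move=> cQ nab; elim: k st => [|k IH] st /= hQ hk hp.
  by case: (running st v) hk hp => //= /(_ isT) h1 /(_ isT); rewrite ltnNge h1.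
rewrite -[RHS](mean_const 0); apply: eq_mean => d; apply: IH; first exact: cQ.
  move=> rv; have rv' : running (redraw st d) v := running_step rv.
  by rewrite /= (negPf (nab _ d hQ rv')) rv' addnS -addSn; apply: hk.
move=> /[dup] /running_step rv'; rewrite {1}/running /= negb_or => /andP[_].
by rewrite /commits rv' (negPf (nab _ d hQ rv')) /= -ltnNge.
Qed.

Lemma Ex_settled_eq0 v k st : coherent W st -> unobstructed W st v ->
    (running st v -> 0 < prog st v)%N ->
    (running st v -> tau W v <= k + prog st v)%N ->
  Ex k (fun st' => (running st' v)%:R) st = 0.
Proof.
move=> h top pv hk.
pose Q st := [/\ coherent W st, unobstructed W st v & (running st v -> 0 < prog st v)%N].
have nab st' d : Q st' -> running st' v -> ~~ aborted W (redraw st' d) v.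
  by move=> [h1 h2 h3] rv; apply: settled_survives => //; apply: h3.
apply: (@Ex_running_eq0 Q) => //; last exact: coh_tau.
move=> st' d hQ; have [h1 h2 h3] := hQ; split.
- exact: coherent_nstep.
- exact: unobstructed_nstep.
move=> /running_step rv; have rr : running (redraw st' d) v by [].
by rewrite /= (negPf (nab _ _ hQ rv)) rr.
Qed.

(* Every step is either blocked by a settled rival, which uses up [load], or is
   an independent trial of success probability at least [1 / (5 * D)]. *)
Lemma Ex_running_le v D a k st :
    writing W v -> coherent W st -> unobstructed W st v ->
    (#|live W st v| < D)%N -> (load W st v + a + tau W v <= k)%N ->
  Ex k (fun st' => (running st' v)%:R) st <= (1 - (5 * D)%:R^-1) ^+ a.
Proof.
move=> wv; set p := 1 - _.
elim: k a st => [|k IH] a st h top hD hk; first by have := tau_gt0 v; lia.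
have p0 : 0 <= p.
  by rewrite subr_ge0 invf_le1 ?ltr0n ?ler1n ?muln_gt0 //=; lia.
have [/andP[rv /eqP pv]|] := boolP (running st v && (prog st v == 0)%N); last first.
  rewrite negb_and -lt0n => hp; rewrite Ex_settled_eq0 ?exprn_ge0 //.
    by move=> rv; rewrite rv in hp.
  by move=> rv; lia.
have [/existsP[u /and3P[riv ru pu]]|] :=
    boolP [exists u, [&& rival W u v, running st u & (0 < prog st u)%N]].
  (* A blocked step lowers both [k] and [load], leaving the number [a] of trials intact. *)
  rewrite ExS -[leRHS](mean_const (p ^+ a)); apply: ler_mean => d; apply: IH.
  - exact: coherent_nstep.
  - exact: unobstructed_nstep.
  - exact: leq_ltn_trans (live_nstep _ _ _ _) hD.
  by have := load_blocked d wv h top riv ru pu; lia.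
rewrite negb_exists => /forallP free.
case: a hk => [|a] hk.
  rewrite expr0; exact: Ex_le1.
rewrite exprS ExS.
(* All running rivals have zero progress, so this step is a trial: a win settles [v], a loss leaves
   [a] further trials. *)
apply: le_trans (_ : mean (fun d => (~~ wins (live W st v) v d)%:R * p ^+ a) <= _).
  apply: ler_mean => d; case: (boolP (wins _ v d)) => [/forall_inP wd|_].
    rewrite [X in X * _]/= mul0r Ex_settled_eq0 //.
    - exact: coherent_nstep.
    - exact: unobstructed_nstep.
    - move=> _; have rr : running (redraw st d) v by [].
      rewrite /= ifN ?rr //; apply: free_survives => // u riv ru.
      split; first by have := free u; rewrite riv ru lt0n negbK => /eqP.
      by apply: wd; rewrite !inE riv.
    by move=> _; lia.
  rewrite [X in X * _]/= mul1r; apply: IH.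
  - exact: coherent_nstep.
  - exact: unobstructed_nstep.
  - exact: leq_ltn_trans (live_nstep _ _ _ _) hD.
  by have := load_nstep d wv h top; lia.
rewrite meanZ ler_wpM2r ?exprn_ge0 //; apply: mean_lose_le => //.
by rewrite !inE /rival eqxx.
Qed.

Definition pending (S : {set 'I_n}) st : F := \sum_(v in S) (running st v)%:R.

Lemma pendingE S st : pending S st = #|[set v in S | running st v]|%:R.
Proof.
rewrite /pending -natr_sum -sum1_card; congr _%:R; rewrite big_mkcond [RHS]big_mkcond /=.
by apply: eq_bigr => v _; rewrite inE; case: (v \in S); case: running.
Qed.

(** At least half of the pending transactions have fewer than [D] pending rivals. [L] steps leave
    room for [5 * D] trials, so each of these stays pending with probability at most 1/2. *)
Lemma Ex_pending_le (S : {set 'I_n}) (D L t : nat) st :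
    (forall v, v \in S -> writing W v) ->
    (forall u v, v \in S -> rival W u v -> u \in S) ->
    (forall v, v \in S -> tau W v <= t)%N ->
    (D * t + 5 * D <= L)%N ->
    (forall A : {set 'I_n}, A \subset S ->
      #|A| <= 2 * #|[set v in A | #|rivals W v :&: A| < D]|)%N ->
    coherent W st -> (forall v, v \in S -> unobstructed W st v) ->
  Ex L (pending S) st <= 3%:R / 4%:R * pending S st.
Proof.
move=> wS rS tS hL hlow h top.
pose A := [set v in S | running st v]; pose B := [set v in A | #|rivals W v :&: A| < D]%N.
have liveE v : v \in S -> live W st v = rivals W v :&: A.
  move=> vS; apply/setP => u; rewrite !inE; case riv: (rival W u v) => //=.
  by rewrite (rS _ _ vS riv).
have halfB v : v \in B -> Ex L (fun st' => (running st' v)%:R) st <= 2%:R^-1.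
  rewrite !inE -andbA => /and3P[vS rv dv].
  apply: le_trans (_ : (1 - (5 * D)%:R^-1) ^+ (5 * D) <= _).
    apply: Ex_running_le; [exact: wS|by []|exact: top|by rewrite liveE|].
    (* Fewer than [D] rivals owe at most [t] each, so their load and the execution time of [v]
       together fit into [D * t]. *)
    apply: leq_trans hL; rewrite addnAC leq_add2r.
    apply: leq_trans (_ : #|live W st v| * t + t <= _)%N; last first.
      by rewrite addnC -mulSn leq_mul2r liveE // dv orbT.
    apply: leq_add; last exact: tS.
    rewrite -sum_nat_const; apply: leq_sum => u; rewrite !inE => /andP[riv _].
    by apply: leq_trans (leq_subr _ _) (tS _ (rS _ _ vS riv)).
  have N0 : (0 < 5 * D)%N by rewrite muln_gt0 (leq_ltn_trans _ dv).
  have := expn_half_bound N0; set N := (5 * D)%N in N0 * => hN.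
  have -> : 1 - N%:R^-1 = N.-1%:R / N%:R :> F.
    have NF : N%:R != 0 :> F by rewrite pnatr_eq0; lia.
    have e : N%:R = N.-1%:R + 1 :> F by rewrite natr1 prednK.
    by rewrite e; field; rewrite -e.
  rewrite expr_div_n ler_pdivrMr ?exprn_gt0 ?ltr0n // -!natrX ler_pdivlMl ?ltr0n //.
  by rewrite -natrM ler_nat.
rewrite {1}/pending Ex_sum (bigID [in B]) /=.
have BA : B \subset A by apply/subsetP => v; rewrite inE => /andP[].
have AS : A \subset S by apply/subsetP => v; rewrite inE => /andP[].
have h1 : \sum_(v in S | v \in B) Ex L (fun st' => (running st' v)%:R) st <= #|B|%:R / 2%:R.
  rewrite mulr_natl -sumr_const big_mkcond [leRHS]big_mkcond /=; apply: ler_sum => v _.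
  case vB: (v \in B); last by rewrite andbF.
  by case: ifP => // _; rewrite ?halfB // invr_ge0 ler0n.
have h2 : \sum_(v in S | v \notin B) Ex L (fun st' => (running st' v)%:R) st <= #|A :\: B|%:R.
  rewrite -sumr_const big_mkcond [leRHS]big_mkcond /=; apply: ler_sum => v _.
  rewrite in_setD; case: ifP => [/andP[vS vB]|_]; last by case: ifP.
  rewrite vB /= !inE vS /=; case: ifP => [rv|/negbT nrv]; first exact: Ex_le1.
  by rewrite Ex_settled_eq0 //; [exact: top | move=> rv; rewrite rv in nrv..].
apply: le_trans (lerD h1 h2) _; rewrite pendingE -/A.
have := hlow _ AS; rewrite -/B => hB.
rewrite cardsD (setIidPr BA) natrB ?subset_leq_card //.
have : (#|A|%:R <= 2%:R * #|B|%:R :> F) by rewrite -natrM ler_nat.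
lra.
Qed.

Lemma Ex_pending_iter (S : {set 'I_n}) (D L t k : nat) st :
    (forall v, v \in S -> writing W v) ->
    (forall u v, v \in S -> rival W u v -> u \in S) ->
    (forall v, v \in S -> tau W v <= t)%N ->
    (D * t + 5 * D <= L)%N ->
    (forall A : {set 'I_n}, A \subset S ->
      #|A| <= 2 * #|[set v in A | #|rivals W v :&: A| < D]|)%N ->
    coherent W st -> (forall v, v \in S -> unobstructed W st v) ->
  Ex (k * L) (pending S) st <= (3%:R / 4%:R) ^+ k * #|S|%:R.
Proof.
move=> wS rS tS hL hlow h top.
pose Q st := coherent W st /\ (forall v, v \in S -> unobstructed W st v).
have cQ st' d : Q st' -> Q (nstep W st' d).
  by case=> h1 h2; split=> [|v /h2]; [exact: coherent_nstep|exact: unobstructed_nstep].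
have {h top} : Q st by [].
elim: k st => [|k IH] st hQ.
  rewrite expr0 mul1r /= pendingE ler_nat; apply/subset_leq_card/subsetP => v.
  by rewrite inE => /andP[].
rewrite mulSn addnC Ex_add exprS -mulrA.
apply: le_trans (_ : Ex (k * L) (fun st' => pending S st' * (3%:R / 4%:R)) st <= _).
  apply: (@ler_Ex Q) => // st' [h1 h2]; rewrite mulrC.
  exact: (Ex_pending_le wS rS tS hL hlow).
rewrite ExZ mulrC ler_pM2l ?divr_gt0 ?ltr0n //; exact: IH.
Qed.
End Expectation.

(** * From expectations to counting samples *)

Section FailureProbability.
Import GRing.Theory Num.Theory Order.TTheory.
Import mathcomp.algebra_tactics.ring.
Local Open Scope ring_scope.

Variables (F : realFieldType) (n s : nat) (W : workload n s).
Hypothesis n_gt1 : (1 < n)%N.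
Hypothesis tau_gt0 : forall i, (0 < tau W i)%N.
Local Notation draw := {ffun 'I_n -> 'I_n}.
Local Notation sample T := {ffun 'I_T.+1 * 'I_n -> 'I_n}.
Local Notation Ex := (@Ex F n s W).
Implicit Types (st : state n).

Definition cons_draw T (p : draw * sample T) : sample T.+1 :=
  [ffun q => if unlift ord0 q.1 is Some t then p.2 (t, q.2) else p.1 q.2].

Lemma cons_draw_bij T : bijective (@cons_draw T).
Proof.
exists (fun om : sample T.+1 => ([ffun i => om (ord0, i)] : draw,
                                [ffun q => om (lift ord0 q.1, q.2)] : sample T)).
  move=> [d om]; congr (_, _); apply/ffunP.
    by move=> i; rewrite !ffunE /= unlift_none.
  by move=> [t i]; rewrite !ffunE /= liftK.
move=> om; apply/ffunP => -[t i]; rewrite !ffunE /=.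
by case: unliftP => [t' ->|->]; rewrite ?ffunE.
Qed.

Lemma drawfun_cons0 T (p : draw * sample T) : drawfun (cons_draw p) 0 = p.1.
Proof.
apply: functional_extensionality => i; rewrite /drawfun insubT /= ffunE /=.
by rewrite (_ : Sub _ _ = ord0) ?unlift_none //; apply: val_inj.
Qed.

Lemma drawfun_consS T (p : draw * sample T) t :
  drawfun (cons_draw p) t.+1 = drawfun p.2 t.
Proof.
apply: functional_extensionality => i; rewrite /drawfun.
case: (ltnP t T.+1) => tT; last by rewrite !insubF // ltnNge ?ltnS tT.
have -> : insub t.+1 = Some (lift ord0 (Ordinal tT)) :> option 'I_T.+2.
  by rewrite insubT; congr Some; apply: val_inj.
have -> : insub t = Some (Ordinal tT) by rewrite insubT; congr Some; apply: val_inj.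
by rewrite ffunE liftK.
Qed.

(** Splitting off the first row of a sample mirrors the recursion of [Ex]. Only the first [T] of the
    [T.+1] rows are read, so the case [T = 0] is a constant sum. *)
Lemma sum_nrun T (f : state n -> F) st :
  \sum_(om : sample T) f (nrun W st (drawfun om) T) = #|sample T|%:R * Ex T f st.
Proof.
elim: T st => [|T IH] st; first by rewrite /= sumr_const mulr_natl.
rewrite (reindex _ (onW_bij _ (cons_draw_bij T))) /=.
rewrite (eq_bigr (fun p : draw * sample T =>
  f (nrun W (nstep W st p.1) (drawfun p.2) T))); last first.
  move=> p _; rewrite drawfun_cons0; congr (f (nrun _ _ _ _)).
  by apply: functional_extensionality => t; apply: drawfun_consS.
rewrite -(pair_big xpredT xpredT (fun (d : draw) (om : sample T) =>
  f (nrun W (nstep W st d) (drawfun om) T))) /=.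
under eq_bigr do rewrite IH.
rewrite -mulr_sumr -(bij_eq_card (cons_draw_bij T)) card_prod natrM /mean.
have : #|draw|%:R != 0 :> F by rewrite pnatr_eq0 card_ffun !card_ord expn_eq0; lia.
by move=> ?; field.
Qed.

(** * Clearing an ordered chain of classes *)

Section Classes.
Variables (S : nat -> {set 'I_n}) (C : nat) (D L t : nat -> nat).
Hypothesis S_writing : forall c v, v \in S c -> writing W v.
Hypothesis S_rival : forall c u v, v \in S c -> rival W u v -> u \in S c.
Hypothesis S_lt : forall c u v,
  v \in S c -> sub_lt W u v -> exists2 c', (c' < c)%N & u \in S c'.
Hypothesis S_cover : forall v, writing W v -> exists2 c, (c < C)%N & v \in S c.
Hypothesis S_disj : forall c c' v, v \in S c -> v \in S c' -> c = c'.
Hypothesis S_tau : forall c v, v \in S c -> (tau W v <= t c)%N.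
Hypothesis L_ge : forall c, (D c * t c + 5 * D c <= L c)%N.
Hypothesis S_low : forall c (A : {set 'I_n}), A \subset S c ->
  (#|A| <= 2 * #|[set v in A | #|rivals W v :&: A| < D c]|)%N.

Definition behind c st := [exists u, [exists c' : 'I_c, u \in S c'] && running st u].

Lemma behindPn c st : reflect (forall c' u, (c' < c)%N -> u \in S c' -> done st u) (~~ behind c st).
Proof.
apply: (iffP idP) => [/existsPn h c' u lc uS|h].
  apply: contraT => ru; have := h u; rewrite /running ru andbT => /negP[].
  by apply/existsP; exists (Ordinal lc).
apply/existsPn => u; apply/negP => /andP[/existsP[c' uS]].
by rewrite /running (h c').
Qed.

(** Union bound along the chain: either an earlier class is unfinished, or the current class is
    unobstructed and the contraction of [Ex_pending_iter] applies. *)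
Lemma Ex_behind k c st : coherent W st ->
  Ex (k * \sum_(c' < c) L c') (fun st' => (behind c st')%:R) st
    <= (3%:R / 4%:R) ^+ k * (\sum_(c' < c) #|S c'|)%:R.
Proof.
move=> hst; elim: c => [|c IH].
  rewrite !big_ord0 muln0 mulr0 /= (_ : behind 0 st = false) //.
  by apply/negbTE/behindPn.
rewrite !big_ord_recr /= mulnDr Ex_add natrD mulrDr.
set e := (3%:R / 4%:R) ^+ k; have e0 : 0 <= e by rewrite exprn_ge0 // divr_ge0 ?ler0n.
apply: le_trans (_ : Ex (k * \sum_(c' < c) L c')
  (fun st' => (behind c st')%:R + e * #|S c|%:R) st <= _); last first.
  by rewrite ExD Ex_const // lerD2r.
apply: (@ler_Ex _ _ _ _ n_gt1 (coherent W)) => // [st' d|st' h]; first exact: coherent_nstep.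
have [_|nb] := boolP (behind c st').
  by apply: le_trans (Ex_le1 _ _ n_gt1 _ _ _) _; rewrite lerDl mulr_ge0 ?ler0n.
rewrite add0r; apply: le_trans (_ : Ex (k * L c) (pending F (S c)) st' <= _); last first.
  apply: (@Ex_pending_iter _ _ _ _ n_gt1 tau_gt0 _ (D c) _ (t c)) => //.
  - exact: S_writing.
  - exact: S_rival.
  - exact: S_tau.
  - exact: S_low.
  move=> v vS u /(S_lt vS)[c' lc uS]; exact: (behindPn _ _ nb c').
apply: (@ler_Ex _ _ _ _ n_gt1 (fun st => ~~ behind c st)) => //
  [st1 d /behindPn nb1|st1 /behindPn nb1].
  by apply/behindPn => c' u lc /(nb1 _ _ lc); apply: done_nstep.
(* Markov's inequality: the indicator is at most the number of pending members of [S c]. *)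
rewrite pendingE; case: (posnP #|[set v in S c | running st1 v]|) => [/cards0_eq e0'|p0].
  rewrite (_ : behind c.+1 st1 = false) ?ler0n //; apply/negbTE/behindPn => c' u.
  rewrite ltnS leq_eqVlt => /orP[/eqP ->|lc]; last exact: nb1.
  move=> uS; apply/negPn/negP => ru; have : u \in set0 by rewrite -e0' inE uS.
  by rewrite inE.
by case: behind; rewrite ?ler0n // ler1n.
Qed.

(** Once all classes are cleared only read-only transactions run; they conflict with nobody and
    finish within the last [r] steps. Disjointness bounds the total class size by [n]. *)
Lemma Ex_not_all_done k r st : coherent W st -> (tau_max W <= r)%N ->
  Ex (k * (\sum_(c < C) L c) + r) (fun st' => (~~ all_done st')%:R) st
    <= (3%:R / 4%:R) ^+ k * n%:R.
Proof.
move=> hst hr; rewrite Ex_add.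
apply: le_trans (_ : Ex (k * \sum_(c < C) L c) (fun st' => (behind C st')%:R) st <= _); last first.
  apply: le_trans (Ex_behind k C hst) _.
  rewrite ler_pM2l ?exprn_gt0 ?divr_gt0 ?ltr0n // ler_nat.
  have -> : (\sum_(c < C) #|S c| = \sum_(v : 'I_n) \sum_(c < C) (v \in S c))%N.
    rewrite exchange_big /=; apply: eq_bigr => c _; rewrite -sum1_card big_mkcond /=.
    by apply: eq_bigr => v _; case: (v \in S c).
  rewrite -[leqRHS](card_ord n) -sum1_card; apply: leq_sum => v _.
  have [c vc|none] := pickP (fun c : 'I_C => v \in S c).
    rewrite (bigD1 c) //= vc big1 // => c' /negPf nc; apply/eqP; rewrite eqb0.
    by apply/negP => vc'; move: nc; rewrite -val_eqE /= (S_disj vc vc') eqxx.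
  by rewrite big1 // => c _; rewrite none.
apply: (@ler_Ex _ _ _ _ n_gt1 (coherent W)) => // [st' d|st' h]; first exact: coherent_nstep.
have [_|/behindPn nb] := boolP (behind C st'); first exact: (Ex_le1 _ _ n_gt1).
apply: le_trans (_ : Ex r (pending F setT) st' <= _).
  apply: (@ler_Ex _ _ _ _ n_gt1 xpredT) => // st1 _; rewrite pendingE.
  case: (boolP (all_done st1)) => [_|/forallPn[v nv]]; first by rewrite ler0n.
  by rewrite ler1n; apply/card_gt0P; exists v; rewrite !inE.
rewrite /pending Ex_sum big1 // => v _.
pose Q st := forall u, writing W u -> done st u.
apply: (@Ex_running_eq0 _ _ _ _ n_gt1 Q).
- by move=> st1 d hQ u /hQ; apply: done_nstep.
- move=> st1 d hQ rv; apply/negP => /andP[_ /existsP[u /and4P[_ ru cf _]]].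
  have wE x : running st1 x -> wrset W x = set0.
    by move=> rx; apply/eqP/negPn/negP => wx; move: rx; rewrite /running hQ.
  by move: cf; rewrite /conflict !wE // setI0 set0I eqxx.
- by move=> u /S_cover[c lc]; apply: nb.
- move=> _; apply: leq_trans (leq_addr _ _); apply: leq_trans hr.
  exact: (leq_bigmax_cond _ (F := tau W)).
exact: coh_tau.
Qed.
End Classes.
End FailureProbability.

(** * Subgroups and the optimal makespan *)

Section Subgroups.
Import GRing.Theory Num.Theory Order.TTheory.
Import mathcomp.algebra_tactics.ring.

Variables (n s : nat) (W : workload n s).
Hypothesis tau_gt0 : forall i, 0 < tau W i.
Implicit Types (u v : 'I_n) (r : 'I_s) (i j : nat).

Lemma tau_le_max u : tau W u <= tau_max W.
Proof. exact: (leq_bigmax_cond _ (F := tau W)). Qed.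

Lemma tau_min_le u : tau_min W <= tau W u.
Proof.
rewrite /tau_min; have : u \in index_enum 'I_n by rewrite mem_index_enum.
elim: (index_enum _) => // x l IH; rewrite in_cons big_cons geq_min.
by case/orP => [/eqP -> | /IH ->]; rewrite ?leqnn ?orbT.
Qed.

Lemma tau_min_gt0 : 0 < n -> 0 < tau_min W.
Proof.
move=> n0; rewrite /tau_min; apply: (big_ind (fun x => 0 < x)) => //.
  exact: leq_trans (tau_gt0 (Ordinal n0)) (tau_le_max _).
by move=> x y x0 y0; rewrite leq_min x0.
Qed.

Definition base_time i := 2 ^ i * tau_min W.

Lemma base_time_gt0 i : 0 < n -> 0 < base_time i.
Proof. by move=> n0; rewrite muln_gt0 expn_gt0 tau_min_gt0. Qed.

Lemma gidx_tau u : base_time (gidx W u) <= tau W u < 2 * base_time (gidx W u).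
Proof.
have m0 : 0 < tau_min W by apply/tau_min_gt0/leq_ltn_trans/ltn_ord.
have d0 : 0 < tau W u %/ tau_min W by rewrite divn_gt0 // tau_min_le.
have /andP[h1 h2] := trunc_log_bounds (isT : 1 < 2) d0.
by rewrite /base_time -leq_divRL // h1 mulnA -expnS -ltn_divLR.
Qed.

Lemma gidx_ell u : gidx W u < ell W.
Proof.
have m0 : 0 < tau_min W by apply/tau_min_gt0/leq_ltn_trans/ltn_ord.
have d0 : 0 < tau W u %/ tau_min W by rewrite divn_gt0 // tau_min_le.
have /andP[h1 _] := trunc_log_bounds (isT : 1 < 2) d0.
rewrite ltnS /gidx -(leq_exp2l (m := 2)) //; apply: leq_trans h1 _.
apply: leq_trans (up_logP _ _) => //; apply: leq_div2r.
by have := tau_le_max u; lia.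
Qed.

Lemma sidx_lambda u : 0 < lambda W u ->
  2 ^ sidx W u <= lambda W u < 2 ^ (sidx W u).+1.
Proof. exact: trunc_log_bounds. Qed.

(** This crude range suffices, because the later sum over [j] is bounded for any number of terms. *)
Lemma sidx_le u : 0 < lambda W u -> sidx W u < s.+1.
Proof.
move=> l0; have /andP[h _] := sidx_lambda l0; rewrite ltnS ltnW //.
apply: leq_trans (ltn_expl _ (isT : 1 < 2)) (leq_trans h _).
by have := max_card [in resources W u]; rewrite card_ord.
Qed.

Definition subgroup i j := [set u | [&& writing W u, gidx W u == i & sidx W u == j]].
Definition writers i j r := [set u in subgroup i j | r \in wrset W u].
Definition crowd i j := \max_(r < s) #|writers i j r|.

Lemma writers_le_crowd i j r : #|writers i j r| <= crowd i j.
Proof. exact: (leq_bigmax_cond _ (F := fun r => #|writers i j r|)). Qed.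

Lemma interval_count M a b : a + b <= M -> b <= \sum_(x < M) (a <= x < a + b).
Proof.
move=> abM; rewrite -(big_mkord xpredT (fun x => nat_of_bool (a <= x < a + b))).
rewrite (big_cat_nat (n := a)) ?(leq_trans _ abM) ?leq_addr //=.
rewrite (big_cat_nat (m := a) (n := a + b)) ?leq_addr //=.
apply: leq_trans (leq_addl _ _); apply: leq_trans (leq_addr _ _).
rewrite big_nat (eq_bigr (fun=> 1)) => [|x ->//].
by rewrite -big_nat sum_nat_const_nat addKn muln1.
Qed.

(** Pairwise conflicting transactions occupy disjoint time intervals, so each time step is counted
    at most once. *)
Lemma sum_tau_le (A : {set 'I_n}) start : feasible W start ->
    {in A &, forall u v, u != v -> conflict W u v} ->
  \sum_(u in A) tau W u <= sched_makespan W start.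
Proof.
move=> feas cf; set M := sched_makespan _ _.
apply: leq_trans (_ : \sum_(u in A) \sum_(x < M) (start u <= x < start u + tau W u) <= _).
  apply: leq_sum => u _; apply: interval_count.
  exact: (leq_bigmax_cond _ (F := fun u => start u + tau W u)).
rewrite exchange_big /= -[leqRHS]card_ord -sum1_card; apply: leq_sum => x _.
have [u /andP[uA hu]|none] := pickP (fun u => (u \in A) && (start u <= x < start u + tau W u)).
  rewrite (bigD1 u) //= hu big1 // => v /andP[vA vu]; apply/eqP; rewrite eqb0.
  by have [] := feas _ _ vu (cf _ _ vA uA vu); lia.
by rewrite big1 // => u uA; have := none u; rewrite uA /= => ->.
Qed.

Lemma writers_conflict i j r :
  {in writers i j r &, forall u v, u != v -> conflict W u v}.
Proof.
move=> u v; rewrite !inE => /andP[_ ru] /andP[_ rv] _; apply/orP; left.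
by apply/set0Pn; exists r; rewrite !inE ru rv orbT.
Qed.

(** The writers of one resource form a clique of transactions lasting at least [base_time i]
    each. *)
Lemma crowd_opt i j M : is_opt_makespan W M -> crowd i j * base_time i <= M.
Proof.
case=> -[start [feas <-]] _; have [->|b0] := posnP (base_time i); first by rewrite muln0.
rewrite -leq_divRL //; apply/bigmax_leqP => r _; rewrite leq_divRL //.
apply: leq_trans (sum_tau_le feas (@writers_conflict i j r)).
rewrite -sum_nat_const; apply: leq_sum => u; rewrite !inE => /andP[/and3P[_ /eqP <- _] _].
by case/andP: (gidx_tau u).
Qed.

Lemma tau_max_opt M : is_opt_makespan W M -> tau_max W <= M.
Proof.
case=> -[start [_ <-]] _; apply/bigmax_leqP => u _.
apply: leq_trans (leq_addl (start u) _) _.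
exact: (leq_bigmax_cond _ (F := fun u => start u + tau W u)).
Qed.

Lemma sum_lambda_w_le i j : \sum_(u in subgroup i j) lambda_w W u <= s * crowd i j.
Proof.
rewrite (eq_bigr (fun u => \sum_(r < s) (r \in wrset W u))) => [|u _]; last first.
  rewrite /lambda_w -sum1_card big_mkcond /=.
  by apply: eq_bigr => r _; case: (r \in _).
rewrite exchange_big /= -[s in leqRHS]card_ord -sum_nat_const; apply: leq_sum => r _.
apply: leq_trans (writers_le_crowd i j r); rewrite -sum1_card -big_mkcondr.
by rewrite leq_eqVlt; apply/orP; left; apply/eqP/eq_bigl => u; rewrite !inE.
Qed.

Hypothesis lambda_gt0 : forall u, 0 < lambda W u.

(* The conflict graph may have large degrees (many readers of a resource with one
   writer), but orienting each conflict towards a writer of the contended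
   resource bounds all out-degrees. *)
Definition writer_of v := [set u | (u != v) && (wrset W u :&: resources W v != set0)].

Lemma card_writer_of i j v : v \in subgroup i j ->
  #|writer_of v :&: subgroup i j| <= 2 ^ j.+1 * crowd i j.
Proof.
rewrite inE => /and3P[_ _ /eqP sv].
have /andP[_ lam] := sidx_lambda (lambda_gt0 v); rewrite sv in lam.
apply: leq_trans (_ : lambda W v * crowd i j <= _); last by rewrite leq_mul2r ltnW ?orbT.
rewrite -sum_nat_const; apply: leq_trans (_ : \sum_(r in resources W v) #|writers i j r| <= _).
  rewrite -sum1_card; under [leqRHS]eq_bigr do rewrite -sum1_card big_mkcond.
  rewrite exchange_big /= big_mkcond; apply: leq_sum => u _.
  case: ifP => //; rewrite !inE => /andP[/andP[_ /set0Pn[r]]]; rewrite inE => /andP[ru rv] us.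
  by rewrite (bigD1 r) //= !inE us ru.
by apply: leq_sum => r _; apply: writers_le_crowd.
Qed.

(** Every rival pair is an arc towards a writer in at least one direction, so degrees sum to at most
    twice the out-degrees. *)
Lemma sum_rivals_le i j (A : {set 'I_n}) : A \subset subgroup i j ->
  \sum_(v in A) #|rivals W v :&: A| <= #|A| * (4 * 2 ^ j * crowd i j).
Proof.
move=> AS; pose a v u : nat := (u \in writer_of v) && (u \in A).
have aE v : v \in A -> \sum_(u in A) a v u <= 2 ^ j.+1 * crowd i j.
  move=> vA; apply: leq_trans (card_writer_of (subsetP AS v vA)).
  rewrite -sum1_card big_mkcond [leqRHS]big_mkcond; apply: leq_sum => u _; rewrite /a in_setI.
  by case uA: (u \in A) => //; rewrite (subsetP AS u uA) andbT; case: (u \in _).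
apply: leq_trans (_ : \sum_(v in A) \sum_(u in A) (a v u + a u v) <= _).
  apply: leq_sum => v vA; rewrite -sum1_card big_mkcond [leqRHS]big_mkcond; apply: leq_sum => u _.
  rewrite in_setI; case uA: (u \in A); rewrite ?andbF // andbT.
  rewrite !inE /a vA uA !inE; case: ifP => // /and3P[uv cf _].
  have vu : v != u by rewrite eq_sym.
  rewrite addn_gt0 !lt0b !andbT; apply/orP; case/orP: cf => cf; [left|right].
    by apply/andP.
  by rewrite setIC in cf; apply/andP.
under eq_bigr do rewrite big_split.
rewrite big_split /= [X in _ + X]exchange_big /= addnn -mul2n -sum_nat_const big_distrr /=.
apply: leq_sum => v vA; rewrite (_ : 4 * 2 ^ j = 2 * 2 ^ j.+1) ?expnS ?mulnA //.
by rewrite -!mulnA leq_pmul2l // mulnA -expnS aE.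
Qed.

Definition trial_bound i j := minn (8 * 2 ^ j * crowd i j) #|subgroup i j|.

(** At most half of [A] can reach twice the bound on the average degree. The other entry of the
    minimum exceeds every degree, since nobody is its own rival. *)
Lemma half_low_degree i j (A : {set 'I_n}) : A \subset subgroup i j ->
  #|A| <= 2 * #|[set v in A | #|rivals W v :&: A| < trial_bound i j]|.
Proof.
move=> AS; set B := [set v in A | _].
have BA : B \subset A by apply/subsetP => v; rewrite inE => /andP[].
have [->|/set0Pn[v0 v0A]] := eqVneq A set0; first by rewrite cards0.
have g0 : 0 < crowd i j.
  have := subsetP AS v0 v0A; rewrite inE => /andP[/set0Pn[r rw] h].
  apply: leq_trans (writers_le_crowd i j r); apply/card_gt0P; exists v0.
  by rewrite inE rw (subsetP AS).
have hi v : v \in A :\: B -> 8 * 2 ^ j * crowd i j <= #|rivals W v :&: A|.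
  rewrite !inE => /andP[+ vA]; rewrite vA /= -leqNgt geq_min => /orP[//|].
  rewrite leqNgt => /negP[]; apply: leq_trans (subset_leq_card AS).
  apply: proper_card; apply/properP; split; first exact: subsetIr.
  by exists v => //; rewrite !inE /rival eqxx.
have := sum_rivals_le AS; rewrite (big_setID B) /= => h.
have : \sum_(v in A :\: B) (8 * 2 ^ j * crowd i j) <= #|A| * (4 * 2 ^ j * crowd i j).
  apply: leq_trans h; apply: leq_trans (leq_addl _ _); exact: leq_sum.
rewrite sum_nat_const cardsD (setIidPr BA).
have X0 : 0 < 4 * 2 ^ j * crowd i j by rewrite !muln_gt0 expn_gt0 g0.
rewrite (_ : 8 * 2 ^ j * crowd i j = 2 * (4 * 2 ^ j * crowd i j)); last by rewrite !mulnA.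
rewrite mulnA leq_pmul2r //; move: #|A| #|B| => a b; lia.
Qed.

(** Covers [D * t + 5 * D] for [t = 2 * base_time i], as [base_time i] is at least 1. *)
Definition phase_length i j := 7 * (trial_bound i j * base_time i).

Definition total_length := \sum_(i < ell W) \sum_(j < s.+1) phase_length i j.

(** Lets subgroups be numbered lexicographically, [c] coding group [c %/ b.+1] and subgroup
    [c %% b.+1]. *)
Lemma sum_flatten (f : nat -> nat -> nat) a b :
  \sum_(c < a * b.+1) f (c %/ b.+1) (c %% b.+1) = \sum_(i < a) \sum_(j < b.+1) f i j.
Proof.
elim: a => [|a IH]; first by rewrite mul0n !big_ord0.
rewrite [RHS]big_ord_recr /= -IH mulSnr big_split_ord /=; congr (_ + _).
by apply: eq_bigr => j _; rewrite divnMDl // modnMDl divn_small // modn_small // addn0.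
Qed.

Lemma card_failures k T : 1 < n -> n * n * 3 ^ k <= 4 ^ k ->
    k * total_length + tau_max W <= T ->
  n * #|[set om : {ffun 'I_T.+1 * 'I_n -> 'I_n} | ~~ all_done (run W (drawfun om) T)]|
    <= #|{ffun 'I_T.+1 * 'I_n -> 'I_n}|.
Proof.
rewrite /total_length -sum_flatten => n1 hk hT; set B := [set om | _]; have n0 := ltnW n1.
pose S c := subgroup (c %/ s.+1) (c %% s.+1).
pose d0 : 'I_n -> 'I_n := id.
have SP c v : v \in S c -> [/\ writing W v, gidx W v = c %/ s.+1 & sidx W v = c %% s.+1].
  by rewrite inE => /and3P[? /eqP ? /eqP ?].
have SI v : writing W v -> v \in S (gidx W v * s.+1 + sidx W v).
  move=> wv; have lv := sidx_le (lambda_gt0 v).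
  by rewrite !inE wv divnMDl // modnMDl divn_small // modn_small // addn0 !eqxx.
pose fail := (Ex (F := rat) W T (fun st => (~~ all_done st)%:R) (start_state d0))%R.
have key : (fail <= (3%:R / 4%:R) ^+ k * n%:R)%R.
  rewrite /fail -(subnKC (leq_trans (leq_addr _ _) hT)).
  apply: (@Ex_not_all_done _ _ _ _ n1 tau_gt0 S (ell W * s.+1)
    (fun c => trial_bound (c %/ s.+1) (c %% s.+1))
    (fun c => phase_length (c %/ s.+1) (c %% s.+1)) (fun c => 2 * base_time (c %/ s.+1))).
  - by move=> c v /SP[].
  - move=> c u v /SP[wv gv sv] riv; have wu := rival_writing wv riv.
    move: riv => /and4P[_ _]; rewrite /sub_lt !inE wu wv gv sv /=; lia.
  - move=> c u v /SP[wv gv sv] luv; have wu : writing W u by case/andP: luv.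
    exists (gidx W u * s.+1 + sidx W u); last exact: SI.
    have lu := sidx_le (lambda_gt0 u).
    rewrite [ltnRHS](divn_eq c s.+1); move: luv; rewrite /sub_lt wu wv gv sv /=.
    case/orP => [lt_g|/andP[/eqP -> lt_s]]; last by rewrite ltn_add2l.
    apply: leq_trans (leq_addr _ _); apply: leq_trans (leq_mul lt_g (leqnn s.+1)).
    by rewrite mulSn addnC ltn_add2r.
  - move=> v wv; exists (gidx W v * s.+1 + sidx W v); last exact: SI.
    apply: leq_trans (leq_mul (gidx_ell v) (leqnn s.+1)).
    by rewrite mulSn addnC ltn_add2r sidx_le.
  - move=> c c' v /SP[_ g1 s1] /SP[_ g2 s2].
    by rewrite (divn_eq c s.+1) (divn_eq c' s.+1) -g1 -g2 -s1 -s2.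
  - by move=> c v /SP[_ <- _]; case/andP: (gidx_tau v) => _ /ltnW.
  - move=> c; rewrite /phase_length; have := base_time_gt0 (c %/ s.+1) n0; nia.
  - by move=> c A; apply: half_low_degree.
  - exact: coherent_start.
  - by rewrite leq_subRL ?(leq_trans (leq_addr _ _) hT).
(* On each sample the original run and the one with fresh draws finish the same transactions, so the
   expectation is an exact count. *)
have hB : (#|B|%:R = #|{ffun 'I_T.+1 * 'I_n -> 'I_n}|%:R * fail)%R.
  rewrite -sum_nrun // -GRing.natr_sum; congr (_%:R)%R; rewrite /B -sum1_card big_mkcond /=.
  by apply: eq_bigr => om _; rewrite inE /all_done -(done_run_nrun tau_gt0); case: [forall _, _].
rewrite -(ler_nat rat) natrM hB mulrCA -[leRHS]mulr1 ler_wpM2l ?ler0n //.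
apply: le_trans (_ : (n%:R * ((3%:R / 4%:R) ^+ k * n%:R) <= _)%R).
  by rewrite ler_wpM2l ?ler0n.
have -> : (n%:R * ((3%:R / 4%:R) ^+ k * n%:R) = (n * n * 3 ^ k)%:R / (4 ^ k)%:R :> rat)%R.
  rewrite expr_div_n !natrM -!natrX; ring.
by rewrite ler_pdivrMr ?mul1r ?ler_nat // ltr0n expn_gt0.
Qed.
End Subgroups.

(** * The makespan bound *)

From Stdlib Require Import Reals Lra.
Local Open Scope nat_scope.

Lemma INR_addn m n : INR (m + n) = (INR m + INR n)%R.
Proof. exact: plus_INR. Qed.

Lemma INR_muln m n : INR (m * n) = (INR m * INR n)%R.
Proof. exact: mult_INR. Qed.

Lemma INR_expn m k : INR (expn m k) = (INR m ^ k)%R.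
Proof. by elim: k => // k IH; rewrite expnS INR_muln IH. Qed.

Lemma INR_leq m n : m <= n -> (INR m <= INR n)%R.
Proof. by move/leP; apply: le_INR. Qed.

Lemma leq_INR m n : (INR m <= INR n)%R -> m <= n.
Proof. by move=> h; apply/leP/INR_le. Qed.

Lemma INR_gt0 m : 0 < m -> (0 < INR m)%R.
Proof. by move/ltP; apply: lt_0_INR. Qed.

Lemma sum_min_geometric (x : nat -> nat) (a K M : R) :
    (0 < a)%R -> (0 <= K)%R -> (0 <= M)%R ->
    (forall j, INR (x j) <= a * 2 ^ j * M)%R ->
    (forall j, INR (x j) * 2 ^ j <= K * M)%R ->
  forall N, (INR (\sum_(j < N) x j) <= 3 * sqrt (a * K) * M)%R.
Proof.
move=> a0 K0 M0 h1 h2 N; set q := sqrt _.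
have q0 : (0 <= q)%R by apply: sqrt_pos.
have qq : (q * q = a * K)%R by apply: sqrt_sqrt; nra.
have y0 j : (0 < 2 ^ j)%R by apply: pow_lt; lra.
(* Up to the index where [2 ^ j] passes [sqrt (K / a)] the terms grow
   geometrically, afterwards they decrease geometrically. *)
have [hA hB] : (INR (\sum_(j < N) x j) <= a * 2 ^ N * M)%R /\
    (q <= a * 2 ^ N -> INR (\sum_(j < N) x j) * 2 ^ N <= (3 * q * 2 ^ N - 2 * K) * M)%R.
  elim: N => [|N [hA hB]].
    rewrite big_ord0 /=; split; first by nra.
    move=> qa; rewrite Rmult_0_l; apply: Rmult_le_pos => //.
    have : (a * K <= a * q)%R by nra.
    by move/Rmult_le_reg_l => /(_ a0); lra.
  rewrite big_ord_recr /= INR_addn; have := y0 N.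
  move: (h1 N) (h2 N) hA hB; set X := INR (\sum_(_ < N) _); set z := INR (x N).
  set y := (2 ^ N)%R => hz1 hz2 hA hB yp; split; first by nra.
  (* The term [2 * K] reserves the whole decreasing tail, so a step beyond the crossing preserves
     the bound. *)
  move=> qay; have [qy|qy] := Rle_or_lt q (a * y).
    by have := hB qy; nra.
  (* At the crossing [q] lies between [a * y] and [2 * (a * y)]; expanding a product of two
     nonnegative factors with [q * q = a * K] gives the claim times [a]. *)
  have h : (4 * (a * y) * y <= 6 * q * y - 2 * K)%R.
    apply: (Rmult_le_reg_l a) => //.
    have : (0 <= (2 * (a * y) - q) * (2 * q - 2 * (a * y)))%R by apply: Rmult_le_pos; lra.
    by lra.
  have hX : (X + z <= 2 * (a * y) * M)%R by nra.
  have : ((X + z) * (2 * y) <= 2 * (a * y) * M * (2 * y))%R by apply: Rmult_le_compat_r; lra.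
  by nra.
have yN := y0 N; have [qy|qy] := Rle_or_lt q (a * 2 ^ N).
  apply: (Rmult_le_reg_r (2 ^ N)) => //; have := hB qy; nra.
nra.
Qed.

Lemma INR_sum_ge (I : finType) (A : {set I}) (f : I -> nat) (c : R) :
    (forall u, u \in A -> (c <= INR (f u))%R) ->
  (INR #|A| * c <= INR (\sum_(u in A) f u))%R.
Proof.
move=> h; rewrite -sum1_card; elim/big_rec2: _ => [|u x y /h hu IH]; first by rewrite /=; lra.
by rewrite !INR_addn (_ : INR 1 = 1%R) //; lra.
Qed.

Lemma INR_sum_le N (f : nat -> nat) (c : R) :
  (forall i, (INR (f i) <= c)%R) -> (INR (\sum_(i < N) f i) <= INR N * c)%R.
Proof.
move=> h; elim: N => [|N IH]; first by rewrite big_ord0 /=; lra.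
rewrite S_INR big_ord_recr INR_addn Rmult_plus_distr_r Rmult_1_l.
exact: Rplus_le_compat.
Qed.

Section Times.
Variables (n s : nat) (W : workload n s) (beta : R) (M : nat).
Hypothesis tau_gt0 : forall i, 0 < tau W i.
Hypothesis lambda_gt0 : forall i, 0 < lambda W i.
Hypothesis beta_ratio : is_global_balancing_ratio W beta.
Hypothesis M_opt : is_opt_makespan W M.

Lemma lambda_w_gt0 i : writing W i -> 0 < lambda_w W i.
Proof. by rewrite card_gt0. Qed.

Lemma balancing_gt0 : (0 < beta)%R.
Proof.
have [[i [wi ->]] _] := beta_ratio.
by apply: Rdiv_lt_0_compat; apply: INR_gt0 => //; apply: lambda_w_gt0.
Qed.

Lemma trial_time_le_width i j :
  (INR (trial_bound W i j * base_time W i) <= 8 * 2 ^ j * INR M)%R.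
Proof.
have -> : (8 * 2 ^ j * INR M = INR (8 * expn 2 j * M))%R.
  by rewrite !INR_muln INR_expn; congr (_ * _ ^ _ * _)%R; rewrite /=; lra.
apply: INR_leq; apply: leq_trans (_ : 8 * expn 2 j * crowd W i j * base_time W i <= _).
  by rewrite leq_mul2r geq_minl orbT.
by rewrite -mulnA leq_mul2l crowd_opt ?orbT.
Qed.

Lemma trial_time_le_ratio i j :
  (INR (trial_bound W i j * base_time W i) * 2 ^ j <= INR s / beta * INR M)%R.
Proof.
have b0 := balancing_gt0; have [_ bmin] := beta_ratio.
have y0 : (0 < 2 ^ j)%R by apply: pow_lt; lra.
apply: (Rmult_le_reg_l beta) => //.
have -> : (beta * (INR s / beta * INR M) = INR s * INR M)%R by field; lra.
(* Double counting of writes: each member writes at least [beta * 2 ^ j] resources. *)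
have hS : (INR #|subgroup W i j| * (beta * 2 ^ j) <= INR (s * crowd W i j))%R.
  apply: Rle_trans (INR_leq (sum_lambda_w_le W i j)); apply: INR_sum_ge => u.
  rewrite inE => /and3P[wu _ /eqP su]; have l0 := INR_gt0 (lambda_gt0 u).
  have /andP[/INR_leq lam _] := sidx_lambda (lambda_gt0 u).
  rewrite su INR_expn (_ : INR 2 = 2%R) // in lam.
  apply: Rle_trans (_ : (beta * INR (lambda W u) <= _)%R).
    by apply: Rmult_le_compat_l; lra.
  apply: Rle_trans (Rmult_le_compat_r _ _ _ (Rlt_le _ _ l0) (bmin u wu)) _.
  by right; field; lra.
have := INR_leq (crowd_opt tau_gt0 i j M_opt); rewrite INR_muln => hM.
have hT : (INR (trial_bound W i j) <= INR #|subgroup W i j|)%R.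
  by apply: INR_leq; apply: geq_minr.
have bt0 := pos_INR (base_time W i); rewrite INR_muln in hS; rewrite INR_muln.
apply: Rle_trans (_ : (INR s * (INR (crowd W i j) * INR (base_time W i)) <= _)%R); last first.
  by apply: Rmult_le_compat_l => //; apply: pos_INR.
apply: Rle_trans (_ : (INR #|subgroup W i j| * (beta * 2 ^ j) * INR (base_time W i) <= _)%R).
  have : (0 <= beta * 2 ^ j * INR (base_time W i))%R by apply: Rmult_le_pos => //; nra.
  by move=> p; have := Rmult_le_compat_r _ _ _ p hT; lra.
by have := Rmult_le_compat_r _ _ _ bt0 hS; lra.
Qed.

(** The constant is 7 * 3 * 3: the phase factor, the geometric sum with [a = 8], and 3 as a bound on
    [sqrt 8]. *)
Lemma total_length_le :
  (INR (total_length W) <= 63 * INR (ell W) * sqrt (INR s / beta) * INR M)%R.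
Proof.
have b0 := balancing_gt0; have K0 : (0 <= INR s / beta)%R.
  by apply: Rmult_le_pos; [apply: pos_INR | apply/Rlt_le/Rinv_0_lt_compat].
have M0 := pos_INR M; set q := sqrt _; have q0 : (0 <= q)%R by apply: sqrt_pos.
have h8 : (sqrt (8 * (INR s / beta)) <= 3 * q)%R.
  rewrite -[3%R](sqrt_square 3) -?sqrt_mult_alt; try lra.
  by apply: sqrt_le_1_alt; lra.
apply: Rle_trans (_ : (INR (ell W) * (7 * (3 * (3 * q) * INR M)) <= _)%R); last by lra.
apply: (@INR_sum_le _ (fun i => \sum_(j < s.+1) phase_length W i j)) => i.
rewrite -big_distrr INR_muln /=; apply: Rmult_le_compat; [lra|exact: pos_INR|lra|].
apply: Rle_trans (sum_min_geometric _ K0 M0 (trial_time_le_width i) (trial_time_le_ratio i) _) _.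
  by lra.
by apply: Rmult_le_compat_r => //; lra.
Qed.
End Times.

(** Take [k] just above [8 ln n]: (3/4)^k is at most exp(-k/4), hence at most 1/n^2, and rounding
    costs at most 1, which is below [2 ln n]. *)
Lemma phase_count n : 1 < n ->
  exists2 k, n * n * expn 3 k <= expn 4 k & (INR k <= 10 * ln (INR n))%R.
Proof.
move=> n1; have n2 : (2 <= INR n)%R by apply: (INR_leq n1).
have ln2 : (1 / 2 < ln (INR n))%R.
  apply: Rlt_le_trans (_ : (ln 2 <= _)%R); first by have := ln_lt_2; lra.
  by case: n2 => [h|<-]; [apply/Rlt_le/ln_increasing; lra | right].
have [k1 k2] := archimed (8 * ln (INR n)); set z := up _ in k1 k2.
have z0 : (0 <= z)%Z by apply: le_IZR; lra.
have ek : INR (Z.to_nat z) = IZR z by rewrite INR_IZR_INZ Znat.Z2Nat.id.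
exists (Z.to_nat z); last by rewrite ek; lra.
set k := Z.to_nat z in ek *; apply: leq_INR; rewrite !INR_muln !INR_expn.
have -> : INR 3 = 3%R by rewrite /=; lra.
have -> : INR 4 = (4)%R by rewrite /=; lra.
have h34 : ((3 / 4) ^ k <= exp (- (2 * ln (INR n))))%R.
  apply: Rle_trans (_ : (exp (- (1 / 4)) ^ k <= _)%R).
    by apply: pow_incr; have := exp_ineq1_le (- (1 / 4)); lra.
  have expX x m : (exp x ^ m = exp (INR m * x))%R.
    elim: m => [|m IH]; first by rewrite Rmult_0_l exp_0.
    by rewrite S_INR /= IH -exp_plus; congr exp; lra.
  rewrite expX ek; have [lt|->] : (IZR z * - (1 / 4) <= - (2 * ln (INR n)))%R by lra.
    by apply/Rlt_le/exp_increasing.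
  by right.
have en : (INR n * INR n * exp (- (2 * ln (INR n))) = 1)%R.
  rewrite exp_Ropp (_ : (2 * ln (INR n) = ln (INR n) + ln (INR n))%R); last by lra.
  by rewrite exp_plus exp_ln; [field|]; lra.
have p4 : (0 < 4 ^ k)%R by apply: pow_lt; lra.
have -> : (3 ^ k = (3 / 4) ^ k * 4 ^ k)%R by rewrite -Rpow_mult_distr; congr (_ ^ _)%R; lra.
have nn : (0 <= INR n * INR n)%R by nra.
have := Rmult_le_compat_l _ _ _ nn h34; rewrite en => h.
by have := Rmult_le_compat_r _ _ _ (Rlt_le _ _ p4) h; lra.
Qed.

Theorem mainTheorem11 (n s : nat) (W : workload n s) :
  2 <= n ->
  (forall i, 0 < tau W i) ->
  (forall i, 0 < lambda W i) ->
  (exists i, writing W i) ->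
  forall (beta : R), is_global_balancing_ratio W beta ->
  forall (M : nat), is_opt_makespan W M ->
  forall (T : nat),
    (INR T <= (512 * exp 1 * INR (ell W) * sqrt (INR s / beta) * ln (INR n) + 1)
                * INR M < INR T + 1)%R ->
    (1 - 1 / INR n <= prob_done_by W T)%R.
Proof.
move=> n1 tau_gt0 lambda_gt0 _ beta hb M hM T [_ hT].
have [k hk kln] := phase_count n1.
have n0 : (0 < INR n)%R by apply/INR_gt0/ltnW.
have ht : k * total_length W + tau_max W <= T.
  (* [T] is the integer part of the bound, so an integer below the bound is at most [T]. The summand
     1 in the ratio pays for [tau_max]. *)
  rewrite -ltnS; apply/ltP/INR_lt; rewrite S_INR; apply: Rle_lt_trans hT.
  rewrite INR_addn INR_muln Rmult_plus_distr_r Rmult_1_l.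
  apply: Rplus_le_compat; last exact/INR_leq/tau_max_opt.
  have := total_length_le tau_gt0 lambda_gt0 hb hM; set q := sqrt _ => hL.
  have qM : (0 <= INR (ell W) * q * INR M)%R.
    by apply: Rmult_le_pos; [apply: Rmult_le_pos; [|exact: sqrt_pos]|]; apply: pos_INR.
  apply: Rle_trans (Rmult_le_compat _ _ _ _ (pos_INR k) (pos_INR _) kln hL) _.
  (* The phases cost 10 * 63 = 630, which [512 * exp 1] exceeds. *)
  have e2 : (2 <= exp 1)%R by have := exp_ineq1_le 1; lra.
  have l0 : (0 <= ln (INR n))%R by have := pos_INR k; lra.
  have : (0 <= (512 * exp 1 - 630) * (ln (INR n) * (INR (ell W) * q * INR M)))%R.
    by apply: Rmult_le_pos; [|apply: Rmult_le_pos]; lra.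
  by lra.
have := INR_leq (card_failures tau_gt0 lambda_gt0 n1 hk ht); rewrite INR_muln.
rewrite /prob_done_by; set G := [set om | all_done _]; set B := [set om | ~~ _].
have eB : B = ~: G by apply/setP => om; rewrite !inE.
have p0 : (0 < INR #|{ffun 'I_T.+1 * 'I_n -> 'I_n}|)%R.
  by apply: INR_gt0; rewrite card_ffun card_ord expn_gt0 ltnW.
move: p0; rewrite -(cardsC G) -eB INR_addn => p0 h.
apply: (Rmult_le_reg_r (INR #|G| + INR #|B|)) => //.
rewrite [X in (_ <= X)%R]Rmult_assoc Rinv_l ?Rmult_1_r; last by lra.
have : (INR #|B| <= / INR n * (INR #|G| + INR #|B|))%R.
  apply: (Rmult_le_reg_l (INR n)) => //; rewrite -Rmult_assoc Rinv_r; lra.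
by lra.
Qed.
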